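(* Let $n\geqslant 1$. A pseudo-Boolean function $f\colon\{0,1\}^n\to\mathbb{R}$ is symmetric if and only if it is a shifted $L$-statistic function.
   Context: Write $[m]=\{1,\ldots,m\}$. A pseudo-Boolean function is a map $f\colon\{0,1\}^n\to\mathbb{R}$; it is symmetric if it is invariant under every permutation of its variables. For $\mathbf{x}\in\{0,1\}^n$, let $x_{(1)}\leqslant\cdots\leqslant x_{(n)}$ be the coordinates rearranged in ascending order. For $k\in[n]$, the $k$th order statistic function $\mathrm{os}_k\colon\{0,1\}^n\to\{0,1\}$ is defined by $\mathrm{os}_k(\mathbf{x})=x_{(k)}$; equivalently $\mathrm{os}_k(\mathbf{x})=1$ if $\sum_{i=1}^n x_i\geqslant n-k+1$, and $0$ otherwise. Also $\mathrm{os}_{n+1}\equiv 1$. A shifted $L$-statistic function is a (real) linear combination of the functions $\mathrm{os}_1,\ldots,\mathrm{os}_{n+1}$. *)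

(* Defs.v *)
From mathcomp Require Import all_boot all_order all_fingroup all_algebra.
From mathcomp Require Import reals.

Set Implicit Arguments.
Unset Strict Implicit.
Unset Printing Implicit Defensive.

Import Order.TTheory GRing.Theory Num.Theory.
Local Open Scope ring_scope.

(* {0,1}^n is [n.-tuple bool], with [false] as 0 and [true] as 1. *)
Definition permute_coords (n : nat) (s : 'S_n) (x : n.-tuple bool) :
    n.-tuple bool :=
  [tuple tnth x (s i) | i < n].

Definition symmetric_pbf (R : realType) (n : nat) (f : n.-tuple bool -> R) :
    Prop :=
  forall (s : 'S_n) (x : n.-tuple bool), f (permute_coords s x) = f x.

(* [os k x] is x_(k) for 1 <= k <= n and the constant 1 for k = n.+1; values
   of k outside [1, n.+1] are junk. Since [nth] counts from 0, the k-th smallest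
   coordinate sits at position k.-1; the order on [bool] is false < true. *)
Definition os (n k : nat) (x : n.-tuple bool) : bool :=
  if k == n.+1 then true else nth false (sort <=%O (x : seq bool)) k.-1.

(* Only the coefficients [c 1], ..., [c n.+1] matter. *)
Definition shifted_L_statistic (R : realType) (n : nat)
    (f : n.-tuple bool -> R) : Prop :=
  exists c : nat -> R, forall x : n.-tuple bool,
    f x = \sum_(1 <= k < n.+2) c k * (os k x)%:R.

(* Main.v *)
Require Import Defs.
From mathcomp Require Import all_boot all_order all_fingroup all_algebra.
From mathcomp Require Import reals.

Set Implicit Arguments.
Unset Strict Implicit.
Unset Printing Implicit Defensive.

Import Order.TTheory GRing.Theory.
Local Open Scope ring_scope.

(** On [{0,1}^n] both properties say that [f x] depends only on the Hamming
weight [w = count id x].  For symmetric functions this holds because two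
Boolean vectors of the same weight are rearrangements of each other
([symmetric_pbfP]).  For shifted L-statistics it holds because [os k] is the
threshold function [w >= n + 1 - k] ([osE]).

Conversely, every function [g] of the weight is a combination of these
thresholds, by Abel summation: [os n.+1] contributes the constant [g 0], and
raising the weight from [n - k] to [n + 1 - k] switches on [os k] and nothing
else, so that [os k] must carry the jump [g (n + 1 - k) - g (n - k)].  The jumps
switched on at weight [w] telescope to [g w - g 0]. *)

Lemma sort_bool (s : seq bool) :
  sort <=%O s = nseq (count negb s) false ++ nseq (count id s) true.
Proof.
apply: (sorted_eq le_trans le_anti).
- exact: (sort_sorted le_total).
- have sorted_ones b : path <=%O true (nseq b true) by elim: b => //= b ->.
  elim: (count negb s) => [|a IHa]; first by case: (count id s).
  case: a IHa => [_|a IHa] /=; first by case: (count id s) => //= b.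
  exact: IHa.
- rewrite perm_sort; elim: s => //= -[] s IHs; last by rewrite perm_cons.
  by rewrite perm_sym perm_catC /= perm_cons perm_catC perm_sym.
Qed.

(** The sorted vector is a run of zeros followed by [count id x] ones, so its
[k]-th entry is a one exactly when it lies among the last [count id x]. *)
Lemma osE (n k : nat) (x : n.-tuple bool) : (1 <= k <= n.+1)%N ->
  os k x = (n < k + count id x)%N.
Proof.
case: k => // k /= k_le_n; rewrite /os eqSS.
have size_x : (count id x + count negb x)%N = n.
  by rewrite (count_predC id) size_tuple.
case: eqP => [->|/eqP k_neq_n]; first by rewrite addSn ltnS leq_addr.
have k_lt_n : (k < n)%N by rewrite ltn_neqAle k_neq_n.
rewrite sort_bool nth_cat size_nseq !nth_nseq addSn ltnS.
have -> : (n <= k + count id x)%N = (count negb x <= k)%N.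
  by rewrite -(leq_add2r (count id x) _ k) (addnC (count negb x)) size_x.
case: ltnP => //= zeros_le_k.
by rewrite ltn_subLR // addnC size_x k_lt_n.
Qed.

Lemma perm_permute_coords (n : nat) (s : 'S_n) (x : n.-tuple bool) :
  perm_eq (permute_coords s x) x.
Proof. by apply/tuple_permP; exists s. Qed.

Lemma symmetric_pbfP (R : realType) (n : nat) (f : n.-tuple bool -> R) :
  symmetric_pbf f <->
  forall x y : n.-tuple bool, count id x = count id y -> f x = f y.
Proof.
split=> [f_sym x y eq_xy|f_weight s x]; last first.
  by apply: f_weight; apply/seq.permP/perm_permute_coords.
have /tuple_permP[s xE] : perm_eq x y.
  apply/(perm_sortP le_total le_trans le_anti); rewrite !sort_bool.
  have count_negb (z : n.-tuple bool) : count negb z = (n - count id z)%N.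
    by rewrite -[X in (X - _)%N](size_tuple z) -(count_predC id) addKn.
  by rewrite !count_negb eq_xy.
by rewrite -(f_sym s y); congr f; apply: val_inj.
Qed.

(** The coefficients are written so that the [k]-th one is the jump of [g] at the
weight where [os k] switches on, and the last one is the value at weight 0. *)
Lemma weight_thresholds (R : realType) (n w : nat) (g : nat -> R) :
  (w <= n)%N ->
  \sum_(1 <= k < n.+2)
     (if k == n.+1 then g 0%N else g (n.+1 - k)%N - g (n - k)%N)
       * (n < k + w)%:R = g w.
Proof.
move=> w_le_n; rewrite big_nat_recr //= eqxx addSn ltnS leq_addr mulr1.
rewrite (@big_cat_nat _ _ _ (n.+1 - w)) ?leq_subr ?subn_gt0 //=.
rewrite big_nat big1 ?add0r => [|k /andP[_ k_lt]]; last first.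
  by rewrite ltnNge -ltnS addnC -ltn_subRL k_lt mulr0.
rewrite (telescope_sumr_eq (fun k => - g (n.+1 - k)%N)) ?leq_subr //.
  by rewrite subnn subKn ?leqW // opprK addrAC addNr add0r.
move=> k /andP[k_ge k_lt]; rewrite ltn_eqF //.
have -> : (n < k + w)%N by rewrite addnC -leq_subLR.
by rewrite mulr1 subSS opprK addrC.
Qed.

Theorem proposition1 (R : realType) (n : nat) (n_ge1 : (1 <= n)%N)
    (f : n.-tuple bool -> R) :
  symmetric_pbf f <-> shifted_L_statistic f.
Proof.
rewrite symmetric_pbfP; split=> [f_weight|[c fE] x y eq_xy]; last first.
  by rewrite !fE; apply: eq_big_nat => k k_bounds; rewrite !osE // eq_xy.
(* [f] factors through the weight: evaluate it at any vector of that weight. *)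
pose g w := if [pick y : n.-tuple bool | count id y == w] is Some y
            then f y else 0.
have gE (x : n.-tuple bool) : g (count id x) = f x.
  rewrite /g; case: pickP => [y /eqP /f_weight //|/(_ x)].
  by rewrite eqxx.
exists (fun k => if k == n.+1 then g 0%N else g (n.+1 - k)%N - g (n - k)%N).
move=> x; rewrite -gE -(@weight_thresholds _ n); last first.
  by rewrite -[leqRHS](size_tuple x) count_size.
by apply: eq_big_nat => k k_bounds; rewrite osE.
Qed.
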